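(* In $\mathbf{ZF}$, for every uncountable set $X$: (i) $\mathbf{CAC}(X^{\omega})$ implies that $\mathbf{S}(X,[X]^{\leq\omega})$, $\mathbf{S}_{\mathcal{P}}(X,[X]^{\leq\omega})$ and $2^X[[X]^{\leq\omega}]$ are all $P$-spaces. (ii) If $|X|=|X^{\omega}|$, then $\mathbf{CAC}(X)$ implies that $\mathbf{S}(X,[X]^{\leq\omega})$, $\mathbf{S}_{\mathcal{P}}(X,[X]^{\leq\omega})$ and $2^X[[X]^{\leq\omega}]$ are all $P$-spaces. (iii) If $\mathbf{S}(X,[X]^{\leq\omega})$ is a $P$-space, then $X$ cannot be expressed as a countable union of countable sets.
   Context: The background theory is $\mathbf{ZF}$ (no axiom of choice). A set is countable if it injects into $\omega$, uncountable otherwise. $X^{\omega}$ is the set of functions $\omega\to X$; $|X|=|Y|$ means there is a bijection. $[X]^{<\omega}$, $[X]^{\leq\omega}$ are the sets of finite, respectively countable, subsets of $X$. For a set $Y$, $\mathbf{CAC}(Y)$ is the statement: every countable family of non-empty subsets of $Y$ has a choice function. For $\mathcal{Z}=[X]^{\leq\omega}$ and $\mathcal{A}\subseteq\mathcal{P}(X)$, $\mathbf{S}_{\mathcal{A}}(X,\mathcal{Z})$ is the set $\mathcal{A}$ with the topology consisting of all $V\subseteq\mathcal{A}$ such that for every $x\in V$ there is $z\in\mathcal{Z}$ with $x\cap z=\emptyset$ and $\{y\in\mathcal{A}:x\subseteq y\subseteq X\setminus z\}\subseteq V$. $\mathbf{S}_{\mathcal{P}}(X,\mathcal{Z})=\mathbf{S}_{\mathcal{P}(X)}(X,\mathcal{Z})$,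 $\mathbf{S}(X,\mathcal{Z})=\mathbf{S}_{[X]^{<\omega}}(X,\mathcal{Z})$. With $2=\{0,1\}$ and $[p]_X=\{f\in 2^X:p\subseteq f\}$ for $p\in 2^z$, $z\in\mathcal{Z}\setminus\{\emptyset\}$, $2^X[\mathcal{Z}]$ is the set $2^X$ with the topology $\{V\subseteq 2^X:(\forall f\in V)(\exists z\in\mathcal{Z}\setminus\{\emptyset\})(\exists p\in 2^z)\ f\in[p]_X\subseteq V\}$. A $P$-space is a topological space in which every $G_\delta$-set (countable intersection of open sets) is open. *)

(* Defs.v *)
From Stdlib Require Import ClassicalEpsilon.

(** * First-order ZF and its models

    "In ZF, phi" is rendered as "phi holds in every model of first-order ZF".
    Separation and Replacement are schemas over first-order formulas, not over
    arbitrary predicates [V -> Prop]: with arbitrary predicates a choice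
    principle of the ambient logic would force the axiom of choice to hold in
    the model. *)

(* De Bruijn indices: [All] and [Ex] bind index 0. *)
Inductive formula : Type :=
| Mem (i j : nat)
| Eql (i j : nat)
| Bot
| Imp (phi psi : formula)
| And (phi psi : formula)
| Or (phi psi : formula)
| All (phi : formula)
| Ex (phi : formula).

Definition scons {V : Type} (x : V) (rho : nat -> V) (n : nat) : V :=
  match n with O => x | S m => rho m end.

Fixpoint sat {V : Type} (E : V -> V -> Prop) (rho : nat -> V) (phi : formula)
  : Prop :=
  match phi with
  | Mem i j => E (rho i) (rho j)
  | Eql i j => rho i = rho j
  | Bot => False
  | Imp p q => sat E rho p -> sat E rho q
  | And p q => sat E rho p /\ sat E rho q
  | Or p q => sat E rho p \/ sat E rho q
  | All p => forall x, sat E (scons x rho) p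
  | Ex p => exists x, sat E (scons x rho) p
  end.

(* In the two schemas the valuation [rho] supplies the parameters. *)
Record ZF_model : Type := {
  carrier :> Type;
  mem : carrier -> carrier -> Prop;
  extensionality : forall a b,
    (forall x, mem x a <-> mem x b) -> a = b;
  foundation : forall a,
    (exists x, mem x a) ->
    exists x, mem x a /\ forall y, mem y x -> ~ mem y a;
  pairing : forall a b, exists c, forall x, mem x c <-> x = a \/ x = b;
  union : forall a, exists b,
    forall x, mem x b <-> exists y, mem y a /\ mem x y;
  power : forall a, exists b,
    forall x, mem x b <-> forall y, mem y x -> mem y a;
  infinity : exists a,
    (exists e, mem e a /\ forall x, ~ mem x e) /\
    forall x, mem x a ->
      exists s, mem s a /\ forall y, mem y s <-> mem y x \/ y = x;
  separation : forall (phi : formula) (rho : nat -> carrier) a,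
    exists b, forall x,
      mem x b <-> mem x a /\ sat mem (scons x rho) phi;
  replacement : forall (phi : formula) (rho : nat -> carrier) a,
    (forall x, mem x a ->
       exists! y, sat mem (scons x (scons y rho)) phi) ->
    exists b, forall y,
      mem y b <-> exists x, mem x a /\ sat mem (scons x (scons y rho)) phi
}.

Arguments mem {_} _ _.

Notation "x ∈ y" := (mem x y) (at level 70, no associativity).
Notation "x ∉ y" := (~ mem x y) (at level 70, no associativity).

Lemma model_inhabited (M : ZF_model) : inhabited M.
Proof. destruct (infinity M) as [a _]. exact (inhabits a). Qed.

(** * Set theory inside a model

    All quantifiers below range over elements of the model. *)

(* [setof P] is the set whose elements are the [x] with [P x], if there is one,
   and is unspecified otherwise.  By extensionality there is at most one such
   set, so [epsilon] is used as a definite description only. *)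
Definition setof {M : ZF_model} (P : M -> Prop) : M :=
  epsilon (model_inhabited M) (fun b => forall x, x ∈ b <-> P x).

Notation "{{ x | P }}" := (setof (fun x => P))
  (at level 0, x name, P at level 200).

Lemma setof_spec {M : ZF_model} (P : M -> Prop) :
  (exists b : M, forall x, x ∈ b <-> P x) -> forall x, x ∈ setof P <-> P x.
Proof.
  intro H. exact (epsilon_spec (model_inhabited M)
                    (fun b => forall x, x ∈ b <-> P x) H).
Qed.

Definition subset {M : ZF_model} (x y : M) : Prop :=
  forall t, t ∈ x -> t ∈ y.

Notation "x ⊆ y" := (subset x y) (at level 70, no associativity).

Definition empty {M : ZF_model} : M := {{ x | False }}.
Definition upair {M : ZF_model} (a b : M) : M := {{ x | x = a \/ x = b }}.
Definition sing {M : ZF_model} (a : M) : M := upair a a.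
Definition opair {M : ZF_model} (a b : M) : M := upair (sing a) (upair a b).
Definition Union {M : ZF_model} (a : M) : M :=
  {{ x | exists y, y ∈ a /\ x ∈ y }}.
Definition powerset {M : ZF_model} (a : M) : M := {{ x | x ⊆ a }}.
Definition cup {M : ZF_model} (a b : M) : M := {{ x | x ∈ a \/ x ∈ b }}.
Definition cap {M : ZF_model} (a b : M) : M := {{ x | x ∈ a /\ x ∈ b }}.
Definition setminus {M : ZF_model} (a b : M) : M := {{ x | x ∈ a /\ x ∉ b }}.
Definition succ {M : ZF_model} (a : M) : M := cup a (sing a).

Definition inductive {M : ZF_model} (I : M) : Prop :=
  empty ∈ I /\ forall x, x ∈ I -> succ x ∈ I.

Definition omega {M : ZF_model} : M :=
  {{ n | forall I, inductive I -> n ∈ I }}.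

(* 2 = {0, 1} with 0 = {} and 1 = {0} *)
Definition two {M : ZF_model} : M := upair empty (sing empty).

Definition is_function {M : ZF_model} (f A B : M) : Prop :=
  (forall p, p ∈ f -> exists x y, x ∈ A /\ y ∈ B /\ p = opair x y) /\
  (forall x, x ∈ A -> exists! y, opair x y ∈ f).

Definition is_injection {M : ZF_model} (f A B : M) : Prop :=
  is_function f A B /\
  forall x x' y, opair x y ∈ f -> opair x' y ∈ f -> x = x'.

Definition is_bijection {M : ZF_model} (f A B : M) : Prop :=
  is_injection f A B /\
  forall y, y ∈ B -> exists x, opair x y ∈ f.

(* [funset A B] is B^A. *)
Definition funset {M : ZF_model} (A B : M) : M := {{ f | is_function f A B }}.

Definition equinumerous {M : ZF_model} (A B : M) : Prop :=
  exists f, is_bijection f A B.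

Definition finite {M : ZF_model} (A : M) : Prop :=
  exists n, n ∈ omega /\ equinumerous A n.

Definition countable {M : ZF_model} (A : M) : Prop :=
  exists f, is_injection f A omega.

Definition uncountable {M : ZF_model} (A : M) : Prop := ~ countable A.

Definition finite_subsets {M : ZF_model} (X : M) : M :=
  {{ a | a ⊆ X /\ finite a }}.

Definition countable_subsets {M : ZF_model} (X : M) : M :=
  {{ a | a ⊆ X /\ countable a }}.

Definition CAC {M : ZF_model} (Y : M) : Prop :=
  forall F, countable F ->
    (forall A, A ∈ F -> A ⊆ Y /\ exists y, y ∈ A) ->
    exists c, is_function c F Y /\
      forall A y, opair A y ∈ c -> y ∈ A.

(** * Topological spaces inside a model *)

Record space (M : ZF_model) : Type := Space { points : M; opens : M }.
Arguments Space {M} _ _.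
Arguments points {M} _.
Arguments opens {M} _.

Definition is_topological_space {M : ZF_model} (T : space M) : Prop :=
  opens T ⊆ powerset (points T) /\
  empty ∈ opens T /\
  points T ∈ opens T /\
  (forall U V, U ∈ opens T -> V ∈ opens T -> cap U V ∈ opens T) /\
  (forall F, F ⊆ opens T -> Union F ∈ opens T).

(* The intersection is taken inside [points T], so the empty family yields the
   whole space. *)
Definition is_Gdelta {M : ZF_model} (T : space M) (G : M) : Prop :=
  exists F, countable F /\ F ⊆ opens T /\
    G = {{ x | x ∈ points T /\ forall U, U ∈ F -> x ∈ U }}.

Definition P_space {M : ZF_model} (T : space M) : Prop :=
  is_topological_space T /\ forall G, is_Gdelta T G -> G ∈ opens T.

(* S_A(X, Z) *)
Definition S_fam {M : ZF_model} (A X Z : M) : space M :=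
  Space A
    {{ V | V ⊆ A /\
           forall x, x ∈ V ->
             exists z, z ∈ Z /\ cap x z = empty /\
               {{ y | y ∈ A /\ x ⊆ y /\ y ⊆ setminus X z }} ⊆ V }}.

(* S_P(X, Z) *)
Definition S_pow {M : ZF_model} (X Z : M) : space M := S_fam (powerset X) X Z.

(* S(X, Z) *)
Definition S_fin {M : ZF_model} (X Z : M) : space M :=
  S_fam (finite_subsets X) X Z.

(* [p]_X *)
Definition extensions {M : ZF_model} (X p : M) : M :=
  {{ f | f ∈ funset X two /\ p ⊆ f }}.

(* 2^X[Z] *)
Definition two_pow {M : ZF_model} (X Z : M) : space M :=
  Space (funset X two)
    {{ V | V ⊆ funset X two /\
           forall f, f ∈ V ->
             exists z, z ∈ setminus Z (sing empty) /\
             exists p, p ∈ funset z two /\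
               f ∈ extensions X p /\ extensions X p ⊆ V }}.

(* Main.v *)
(** All three spaces have the shape: [V] is open iff each [x] in [V] has a
    countable [z] with [{y | N x z y}] contained in [V], where [N x z] shrinks
    as [z] grows.  For a G-delta set, the countable sets [z] working for the
    individual open sets are presented as ranges of functions from omega to [X];
    CAC of [X^omega] chooses one such function per open set, and the union of
    their ranges is countable because the enumerations are given uniformly.
    If [X] is the union of countably many countable sets [c], the open sets
    [{y | y disjoint from c}] meet in the single point [empty]; were that point
    open, a countable [z] would meet every singleton, so [X] would be countable.

    The two schemas are used through [definable] predicates on valuations:
    closure under connectives, quantifiers and definable terms replaces writing
    formulas by hand. *)

From Stdlib Require Import Classical PeanoNat.
Require Import Defs.

(** * Definable predicates *)

(* Interleaves two sequences: [e] at the even positions, [r] at the odd ones. *)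
Fixpoint inter {T : Type} (e r : nat -> T) (n : nat) : T :=
  match n with
  | O => e O
  | S m => inter r (fun k => e (S k)) m
  end.

(** With [f] a valuation and [a], [b] renamings, this lets identities between valuations be checked
    separately on variables and on parameters. *)
Lemma inter_comp {T U : Type} (n : nat) :
  forall (f : T -> U) (a b : nat -> T) (e r : nat -> U),
  (forall k, f (a k) = e k) -> (forall k, f (b k) = r k) ->
  f (inter a b n) = inter e r n.
Proof. induction n; simpl; auto. Qed.

Lemma inter_even {T : Type} (k : nat) : forall (e r : nat -> T),
  inter e r (k + k) = e k.
Proof.
  induction k; intros; simpl; auto.
  rewrite Nat.add_comm; simpl.
  exact (IHk (fun k => e (S k)) (fun k => r (S k))).
Qed.

Lemma inter_odd {T : Type} (k : nat) (e r : nat -> T) :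
  inter e r (S (k + k)) = r k.
Proof. exact (inter_even k r (fun k => e (S k))). Qed.

(** The lift of a renaming under a binder. *)
Definition up (xi : nat -> nat) (n : nat) : nat :=
  match n with O => O | S m => S (xi m) end.

Fixpoint rename (xi : nat -> nat) (phi : formula) : formula :=
  match phi with
  | Mem i j => Mem (xi i) (xi j)
  | Eql i j => Eql (xi i) (xi j)
  | Bot => Bot
  | Imp p q => Imp (rename xi p) (rename xi q)
  | And p q => And (rename xi p) (rename xi q)
  | Or p q => Or (rename xi p) (rename xi q)
  | All p => All (rename (up xi) p)
  | Ex p => Ex (rename (up xi) p)
  end.

Lemma sat_rename {V : Type} (E : V -> V -> Prop) (phi : formula) :
  forall xi rho rho', (forall n, rho (xi n) = rho' n) ->
  (sat E rho (rename xi phi) <-> sat E rho' phi).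
Proof.
  induction phi; simpl; intros xi rho rho' H;
    try (rewrite !H; tauto); try tauto;
    try (rewrite (IHphi1 _ _ _ H), (IHphi2 _ _ _ H); tauto).
  - assert (K : forall x, sat E (scons x rho) (rename (up xi) phi)
                          <-> sat E (scons x rho') phi).
    { intro x. apply IHphi. intros [|n]; simpl; auto. }
    split; intros G x; apply K; apply G.
  - assert (K : forall x, sat E (scons x rho) (rename (up xi) phi)
                          <-> sat E (scons x rho') phi).
    { intro x. apply IHphi. intros [|n]; simpl; auto. }
    split; intros [x G]; exists x; apply K; apply G.
Qed.

(* The odd positions of the valuation hold the parameters. *)
Definition definable {M : ZF_model} (P : (nat -> M) -> Prop) : Prop :=
  exists phi rho, forall e, P e <-> sat mem (inter e rho) phi.

(** The language has no function symbols, so a term is handled through its graph, with the value at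
    position 0. *)
Definition definable_term {M : ZF_model} (f : (nat -> M) -> M) : Prop :=
  definable (fun e => e 0 = f (fun n => e (S n))).

Section Definability.
Context {M : ZF_model}.
Implicit Types P Q : (nat -> M) -> Prop.
Implicit Types f g h : (nat -> M) -> M.

Lemma definable_iff P Q :
  (forall e, P e <-> Q e) -> definable Q -> definable P.
Proof.
  intros H [phi [rho K]]. exists phi, rho. intro e. rewrite H. apply K.
Qed.

(** One sequence can store both parameter lists by interleaving them. As parameters occupy the odd
    positions of the whole valuation, entry [k] of the first list ends up at [4k+1] and entry [k] of
    the second at [4k+3]. *)
Lemma common_parameters P Q : definable P -> definable Q ->
  exists phi psi rho, (forall e, P e <-> sat mem (inter e rho) phi) /\
                      (forall e, Q e <-> sat mem (inter e rho) psi).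
Proof.
  intros [phi [r1 H1]] [psi [r2 H2]].
  exists (rename (inter (fun k => k + k) (fun k => S ((k + k) + (k + k)))) phi),
    (rename (inter (fun k => k + k) (fun k => S (S (k + k) + S (k + k)))) psi),
    (inter r1 r2).
  split; intro e.
  - rewrite H1. symmetry. apply sat_rename. intro n.
    apply inter_comp; intro k.
    + apply inter_even.
    + rewrite inter_odd. apply inter_even.
  - rewrite H2. symmetry. apply sat_rename. intro n.
    apply inter_comp; intro k.
    + apply inter_even.
    + rewrite inter_odd. apply inter_odd.
Qed.

Lemma definable_and P Q :
  definable P -> definable Q -> definable (fun e => P e /\ Q e).
Proof.
  intros HP HQ. destruct (common_parameters _ _ HP HQ) as (phi & psi & rho & H & K).
  exists (And phi psi), rho. intro e. simpl. rewrite H, K. tauto.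
Qed.

Lemma definable_or P Q :
  definable P -> definable Q -> definable (fun e => P e \/ Q e).
Proof.
  intros HP HQ. destruct (common_parameters _ _ HP HQ) as (phi & psi & rho & H & K).
  exists (Or phi psi), rho. intro e. simpl. rewrite H, K. tauto.
Qed.

Lemma definable_imp P Q :
  definable P -> definable Q -> definable (fun e => P e -> Q e).
Proof.
  intros HP HQ. destruct (common_parameters _ _ HP HQ) as (phi & psi & rho & H & K).
  exists (Imp phi psi), rho. intro e. simpl. rewrite H, K. tauto.
Qed.

Lemma definable_False : definable (fun _ : nat -> M => False).
Proof.
  destruct (model_inhabited M) as [m].
  exists Bot, (fun _ => m). simpl. tauto.
Qed.

Lemma definable_not P : definable P -> definable (fun e => ~ P e).
Proof. intro H. apply definable_imp; [exact H | exact definable_False]. Qed.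

Lemma definable_equiv P Q :
  definable P -> definable Q -> definable (fun e => P e <-> Q e).
Proof. intros. apply definable_and; apply definable_imp; assumption. Qed.

(** A quantifier puts its value in front of the whole interleaved valuation and so exchanges even
    and odd positions; the renaming makes it count as a new first variable instead. *)
Lemma sat_inter_scons (phi : formula) (x : M) (e rho : nat -> M) :
  sat mem (scons x (inter e rho))
    (rename (inter (up (fun k => k + k)) (fun k => S (S (k + k)))) phi)
  <-> sat mem (inter (scons x e) rho) phi.
Proof.
  apply sat_rename. intro n. apply inter_comp.
  - intros [|k]; simpl; [reflexivity | apply inter_even].
  - intro k. simpl. apply (inter_odd k e rho).
Qed.

Lemma definable_all (R : M -> (nat -> M) -> Prop) :
  definable (fun e => R (e 0) (fun n => e (S n))) ->
  definable (fun e => forall x, R x e).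
Proof.
  (* The body left open is the renaming of [phi], found by unification with [sat_inter_scons]. *)
  intros [phi [rho H]]. eexists (All _), rho. intro e. simpl.
  split; intros G x.
  - apply sat_inter_scons. apply (H (scons x e)). apply G.
  - specialize (G x). apply sat_inter_scons in G. apply (H (scons x e)) in G.
    exact G.
Qed.

Lemma definable_ex (R : M -> (nat -> M) -> Prop) :
  definable (fun e => R (e 0) (fun n => e (S n))) ->
  definable (fun e => exists x, R x e).
Proof.
  intros [phi [rho H]]. eexists (Ex _), rho. intro e. simpl.
  split; intros [x G]; exists x.
  - apply sat_inter_scons. apply (H (scons x e)). apply G.
  - apply sat_inter_scons in G. apply (H (scons x e)) in G. exact G.
Qed.

Lemma definable_rename (xi : nat -> nat) P :
  definable P -> definable (fun e => P (fun n => e (xi n))).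
Proof.
  intros [phi [rho H]].
  exists (rename (inter (fun k => xi k + xi k) (fun k => S (k + k))) phi), rho.
  intro e. rewrite H. symmetry. apply sat_rename. intro n.
  apply inter_comp; intro k.
  - apply inter_even.
  - apply inter_odd.
Qed.

Lemma definable_mem_var i j : definable (fun e : nat -> M => e i ∈ e j).
Proof.
  destruct (model_inhabited M) as [m].
  exists (Mem (i + i) (j + j)), (fun _ => m). intro e. simpl.
  rewrite !inter_even. tauto.
Qed.

Lemma definable_eq_var i j : definable (fun e : nat -> M => e i = e j).
Proof.
  destruct (model_inhabited M) as [m].
  exists (Eql (i + i) (j + j)), (fun _ => m). intro e. simpl.
  rewrite !inter_even. tauto.
Qed.

Lemma term_var i : definable_term (fun e : nat -> M => e i).
Proof. apply (definable_eq_var 0 (S i)). Qed.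

Lemma term_const (m : M) : definable_term (fun _ => m).
Proof.
  exists (Eql 0 1), (fun _ => m). intro e. simpl. tauto.
Qed.

Lemma term_shift f :
  definable_term f -> definable_term (fun e => f (fun n => e (S n))).
Proof. intro H. exact (definable_rename (up S) _ H). Qed.

(** Substituting a term amounts to quantifying over a name for its value, which uses only the graph
    of the term. *)
Lemma definable_app1 (T : M -> Prop) f :
  definable (fun e => T (e 0)) -> definable_term f ->
  definable (fun e => T (f e)).
Proof.
  intros HT Hf.
  apply definable_iff with (fun e => exists x, x = f e /\ T x).
  - intro e. split.
    + intro H. exists (f e). auto.
    + intros [x [-> H]]. exact H.
  - apply definable_ex. apply definable_and; assumption.
Qed.

Lemma definable_app2 (T : M -> M -> Prop) f g :
  definable (fun e => T (e 0) (e 1)) -> definable_term f -> definable_term g ->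
  definable (fun e => T (f e) (g e)).
Proof.
  intros HT Hf Hg.
  apply definable_iff with (fun e => exists x, x = f e /\ exists y, y = g e /\ T x y).
  - intro e. split.
    + intro H. exists (f e). split; auto. exists (g e). auto.
    + intros (x & -> & y & -> & H). exact H.
  - apply definable_ex. apply definable_and; [exact Hf|].
    apply definable_ex. apply definable_and.
    + exact (term_shift _ Hg).
    (* Under both quantifiers [y] sits at position 0 and [x] at position 1, hence the swap. *)
    + exact (definable_rename (fun n => match n with O => 1 | _ => 0 end) _ HT).
Qed.

Lemma definable_app3 (T : M -> M -> M -> Prop) f g h :
  definable (fun e => T (e 0) (e 1) (e 2)) ->
  definable_term f -> definable_term g -> definable_term h ->
  definable (fun e => T (f e) (g e) (h e)).
Proof.
  intros HT Hf Hg Hh.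
  apply definable_iff with (fun e => exists x, x = f e /\ exists y, y = g e /\
                                     exists z, z = h e /\ T x y z).
  - intro e. split.
    + intro H. exists (f e). split; auto. exists (g e). split; auto. exists (h e). auto.
    + intros (x & -> & y & -> & z & -> & H). exact H.
  - apply definable_ex. apply definable_and; [exact Hf|].
    apply definable_ex. apply definable_and; [exact (term_shift _ Hg)|].
    apply definable_ex. apply definable_and.
    + exact (term_shift _ (term_shift _ Hh)).
    + exact (definable_rename
               (fun n => match n with O => 2 | 1 => 1 | _ => 0 end) _ HT).
Qed.

Lemma definable_mem f g :
  definable_term f -> definable_term g -> definable (fun e => f e ∈ g e).
Proof. apply (definable_app2 mem). apply definable_mem_var. Qed.

Lemma definable_eq f g :
  definable_term f -> definable_term g -> definable (fun e => f e = g e).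
Proof. apply (definable_app2 eq). apply definable_eq_var. Qed.

(** Once the set exists, extensionality determines the value picked by [epsilon], and the graph
    becomes a first-order statement about members. *)
Lemma term_setof (R : M -> (nat -> M) -> Prop) :
  (forall e, exists b, forall x, x ∈ b <-> R x e) ->
  definable (fun e => R (e 0) (fun n => e (S n))) ->
  definable_term (fun e => {{ x | R x e }}).
Proof.
  intros Hex HR.
  apply definable_iff with
    (fun e => forall x, x ∈ e 0 <-> R x (fun n => e (S n))).
  - intro e. pose proof (setof_spec _ (Hex (fun n => e (S n)))) as K. split.
    + intros -> x. apply K.
    + intro H. apply extensionality. intro x. rewrite H, K. tauto.
  - apply definable_all. apply definable_equiv.
    + apply definable_mem_var.
    (* Position 1 now holds the candidate set, which [R] has to skip. *)
    + exact (definable_rename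
               (fun n => match n with O => 0 | S k => S (S k) end) _ HR).
Qed.

End Definability.

(** * Basic set constructions *)

Section Sets.
Context {M : ZF_model}.
Implicit Types a b x y z : M.

(** Since [P] reads only position 0, the remaining variable positions may carry any filler; [a]
    serves. *)
Lemma sep_ex a (P : M -> Prop) : definable (fun e => P (e 0)) ->
  exists b, forall x, x ∈ b <-> x ∈ a /\ P x.
Proof.
  intros [phi [rho H]].
  destruct (separation M
    (rename (inter (up (fun k => k + k)) (fun k => S (S (k + k)))) phi)
    (inter (fun _ => a) rho) a) as [b Hb].
  exists b. intro x. rewrite Hb.
  rewrite (H (scons x (fun _ => a))).
  rewrite (sat_rename mem phi _ _ (inter (scons x (fun _ => a)) rho)); [tauto|].
  intro n. apply inter_comp.
  - intros [|k]; simpl; [reflexivity|].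
    exact (inter_even k _ _).
  - intro k. exact (inter_odd k _ _).
Qed.

(** [P] is the condition as written in a definition, possibly full of nested [setof] terms; [Q] is
    an equivalent form whose definability is easy to check, and [a] bounds it so that Separation
    applies. *)
Lemma setof_sep a (P Q : M -> Prop) :
  (forall x, P x <-> Q x) -> (forall x, Q x -> x ∈ a) ->
  definable (fun e => Q (e 0)) ->
  forall x, x ∈ setof P <-> Q x.
Proof.
  intros HPQ Ha HQ.
  destruct (sep_ex a Q HQ) as [b Hb].
  assert (K : forall x, x ∈ setof P <-> P x).
  { apply setof_spec. exists b. intro x. rewrite Hb, HPQ.
    specialize (Ha x). tauto. }
  intro x. rewrite K. apply HPQ.
Qed.

Lemma repl_ex a (R : M -> M -> Prop) :
  definable (fun e => R (e 0) (e 1)) ->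
  (forall x, x ∈ a -> exists! y, R x y) ->
  exists b, forall y, y ∈ b <-> exists x, x ∈ a /\ R x y.
Proof.
  intros [phi [rho H]] Hun.
  set (psi := rename (inter (fun n => match n with O => 0 | 1 => 1
                              | S (S k) => S (S (k + k)) end)
                            (fun k => S (S (S (k + k))))) phi).
  assert (K : forall x y, sat mem (scons x (scons y (inter (fun _ => a) rho))) psi
                          <-> R x y).
  { intros x y. rewrite (H (scons x (scons y (fun _ => a)))).
    apply sat_rename. intro n. apply inter_comp.
    - intros [|[|k]]; simpl; auto. exact (inter_even k _ _).
    - intro k. exact (inter_odd k _ _). }
  destruct (replacement M psi (inter (fun _ => a) rho) a) as [b Hb].
  - intros x Hx. destruct (Hun x Hx) as [y [Hy Hu]]. exists y. split.
    + apply K. exact Hy.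
    + intros y' Hy'. apply Hu. apply K. exact Hy'.
  - exists b. intro y. rewrite Hb.
    split; intros [x [Hx HR]]; exists x; split; auto; apply K; auto.
Qed.

Lemma in_empty x : x ∉ empty.
Proof.
  intro H. unfold empty in H. rewrite setof_spec in H; [exact H|].
  (* The axiom of infinity also provides an empty set. *)
  destruct (infinity M) as [_ [[e [_ He]] _]].
  exists e. intro t. specialize (He t). tauto.
Qed.

Lemma upair_ex a b : exists c, forall x : M, x ∈ c <-> x = a \/ x = b.
Proof. apply pairing. Qed.

Lemma in_upair a b x : x ∈ upair a b <-> x = a \/ x = b.
Proof. unfold upair. rewrite setof_spec; [tauto | apply upair_ex]. Qed.

Lemma in_sing a x : x ∈ sing a <-> x = a.
Proof. unfold sing. rewrite in_upair. tauto. Qed.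

Lemma in_Union a x : x ∈ Union a <-> exists y, y ∈ a /\ x ∈ y.
Proof. unfold Union. rewrite setof_spec; [tauto | apply union]. Qed.

Lemma in_powerset a x : x ∈ powerset a <-> x ⊆ a.
Proof. unfold powerset. rewrite setof_spec; [tauto | apply power]. Qed.

Lemma cup_ex a b : exists c, forall x : M, x ∈ c <-> x ∈ a \/ x ∈ b.
Proof.
  exists (Union (upair a b)). intro x. rewrite in_Union. split.
  - intros [y [Hy Hx]]. apply in_upair in Hy. destruct Hy; subst; auto.
  - intros [Hx|Hx]; [exists a | exists b]; rewrite in_upair; auto.
Qed.

Lemma in_cup a b x : x ∈ cup a b <-> x ∈ a \/ x ∈ b.
Proof. unfold cup. rewrite setof_spec; [tauto | apply cup_ex]. Qed.

Lemma in_succ a x : x ∈ succ a <-> x ∈ a \/ x = a.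
Proof. unfold succ. rewrite in_cup, in_sing. tauto. Qed.

(** For Kuratowski pairs the singleton member fixes the first coordinate and the unordered pair the
    second; [E2] covers the degenerate case where the two members coincide. *)
Lemma opair_inj a b x y : opair a b = opair x y <-> a = x /\ b = y.
Proof.
  split; [|intros [-> ->]; reflexivity].
  intro H.
  assert (S : forall t, t ∈ opair a b <-> t ∈ opair x y) by (rewrite H; tauto).
  unfold opair in S. setoid_rewrite in_upair in S.
  assert (E1 : forall u v : M, sing u = sing v -> u = v).
  { intros u v E. apply in_sing. rewrite <- E. apply in_sing. reflexivity. }
  assert (E2 : forall u v w : M, sing u = upair v w -> u = v /\ u = w).
  { intros u v w E. split; symmetry; apply in_sing; rewrite E; apply in_upair; auto. }
  assert (E3 : forall u v w : M, upair u v = upair u w -> v = w).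
  { intros u v w E.
    assert (V : v ∈ upair u w) by (rewrite <- E; apply in_upair; auto).
    assert (W : w ∈ upair u v) by (rewrite E; apply in_upair; auto).
    apply in_upair in V, W. destruct V, W; congruence. }
  assert (A : a = x).
  { destruct (proj1 (S (sing a)) (or_introl eq_refl)) as [E|E].
    - auto.
    - apply E2 in E. tauto. }
  subst x. split; [reflexivity|].
  destruct (proj1 (S (upair a b)) (or_intror eq_refl)) as [E|E].
  - symmetry in E. apply E2 in E. destruct E as [_ <-].
    destruct (proj2 (S (upair a y)) (or_intror eq_refl)) as [E|E].
    + symmetry in E. apply E2 in E. tauto.
    + symmetry. exact (E3 _ _ _ E).
  - exact (E3 _ _ _ E).
Qed.

Lemma term_upair (f g : (nat -> M) -> M) :
  definable_term f -> definable_term g ->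
  definable_term (fun e => upair (f e) (g e)).
Proof.
  intros Hf Hg. apply term_setof; [intro e; apply upair_ex|].
  apply definable_or; apply definable_eq; try apply term_var;
    apply term_shift; assumption.
Qed.

Lemma term_opair (f g : (nat -> M) -> M) :
  definable_term f -> definable_term g ->
  definable_term (fun e => opair (f e) (g e)).
Proof. intros. repeat apply term_upair; assumption. Qed.

Lemma term_succ (f : (nat -> M) -> M) :
  definable_term f -> definable_term (fun e => succ (f e)).
Proof.
  intros Hf. apply term_setof; [intro e; apply cup_ex|].
  apply definable_or; apply definable_mem; try apply term_var;
    try apply term_upair; apply term_shift; assumption.
Qed.

End Sets.

(** Follows the syntax of the predicate. Abstract relations are settled by definability hypotheses
    in the context, so such a hypothesis is put there before a call; set-theoretic abbreviations are
    unfolded only afterwards. *)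
Ltac definability :=
  cbv beta;
  lazymatch goal with
  | |- definable_term (fun _ => ?m) => apply term_const
  | |- definable_term (fun e => e _) => apply term_var
  | |- definable_term (fun e => opair _ _) => apply term_opair; definability
  | |- definable_term (fun e => succ _) => apply term_succ; definability
  | |- definable_term _ => idtac
  | |- definable (fun e => _ /\ _) => apply definable_and; definability
  | |- definable (fun e => _ \/ _) => apply definable_or; definability
  | |- definable (fun e => _ <-> _) => apply definable_equiv; definability
  | |- definable (fun e => ~ _) => apply definable_not; definability
  | |- definable (fun e => False) => apply definable_False
  | |- definable (fun e => exists x, _) => apply definable_ex; definability
  | |- definable (fun e => _ ∈ _) => apply definable_mem; definability
  | |- definable (fun e => @eq _ _ _) => apply definable_eq; definability
  | |- _ =>
    first
    [ (apply definable_all; definability)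
    | (apply definable_imp; definability)
    | match goal with
      | H : definable (fun e => ?T (e 0)) |- _ =>
          apply (definable_app1 T); [exact H | definability]
      | H : definable (fun e => ?T (e 0) (e 1)) |- _ =>
          apply (definable_app2 T); [exact H | definability | definability]
      | H : definable (fun e => ?T (e 0) (e 1) (e 2)) |- _ =>
          apply (definable_app3 T);
            [exact H | definability | definability | definability]
      end
    | progress unfold unique, subset, countable, equinumerous, is_bijection,
        is_injection, is_function; definability
    | idtac ]
  end.


(** * Functions as sets of ordered pairs *)

Section Functions.
Context {M : ZF_model}.
Implicit Types A B f x y z : M.

(** Replacement along [x] to [opair x y] yields the graph in one step. *)
Lemma function_build A B (R : M -> M -> Prop) :
  definable (fun e => R (e 0) (e 1)) ->
  (forall x, x ∈ A -> exists! y, R x y) ->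
  (forall x y, x ∈ A -> R x y -> y ∈ B) ->
  exists f, is_function f A B /\ forall x y, opair x y ∈ f <-> x ∈ A /\ R x y.
Proof.
  intros HR Hun HB.
  destruct (repl_ex A (fun x p => exists y, R x y /\ p = opair x y)) as [f Hf].
  - definability.
  - intros x Hx. destruct (Hun x Hx) as [y [Hy Hu]].
    exists (opair x y). split; [exists y; auto|].
    intros p [y' [Hy' ->]]. rewrite (Hu y'); auto.
  - assert (K : forall x y, opair x y ∈ f <-> x ∈ A /\ R x y).
    { intros x y. rewrite Hf. split.
      - intros (x' & Hx & y' & HR' & E). apply opair_inj in E as [-> ->]. auto.
      - intros [Hx Hy]. exists x. split; auto. exists y. auto. }
    exists f. split; [split|exact K].
    + intros p Hp. apply Hf in Hp. destruct Hp as (x & Hx & y & HR' & E).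
      exists x, y. eauto.
    + intros x Hx. destruct (Hun x Hx) as [y [Hy Hu]].
      exists y. split; [apply K; auto|].
      intros y' Hy'. apply K in Hy'. apply Hu. tauto.
Qed.

Lemma function_total f A B x :
  is_function f A B -> x ∈ A -> exists y, y ∈ B /\ opair x y ∈ f.
Proof.
  intros [H1 H2] Hx. destruct (H2 x Hx) as [y [Hy _]].
  destruct (H1 _ Hy) as (x' & y' & _ & Hy' & E).
  apply opair_inj in E as [-> ->]. eauto.
Qed.

Lemma function_range f A B x y :
  is_function f A B -> opair x y ∈ f -> x ∈ A /\ y ∈ B.
Proof.
  intros [H1 _] Hy. destruct (H1 _ Hy) as (x' & y' & Hx & Hy' & E).
  apply opair_inj in E as [-> ->]. auto.
Qed.

Lemma function_single f A B x y y' :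
  is_function f A B -> opair x y ∈ f -> opair x y' ∈ f -> y = y'.
Proof.
  intros Hf Hy Hy'. destruct (function_range _ _ _ _ _ Hf Hy) as [Hx _].
  destruct (proj2 Hf x Hx) as [w [_ Hw]].
  rewrite <- (Hw y Hy). apply Hw. exact Hy'.
Qed.

(** Pairs of members of [A] and [B] lie in the double power set of [cup A B], so functions lie in
    the triple one, which bounds the class. *)
Lemma in_funset A B f : f ∈ funset A B <-> is_function f A B.
Proof.
  apply (setof_sep (powerset (powerset (powerset (cup A B))))
           (fun f => is_function f A B) (fun f => is_function f A B)).
  - tauto.
  - intros g Hg. apply in_powerset. intros p Hp.
    destruct (proj1 Hg _ Hp) as (x & y & Hx & Hy & ->).
    apply in_powerset. intros q Hq. apply in_powerset. intros t Ht.
    apply in_cup. apply in_upair in Hq. unfold sing in Hq.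
    destruct Hq; subst q; apply in_upair in Ht; destruct Ht; subst; auto.
  - definability.
Qed.

End Functions.

(** * Natural numbers *)

Section Omega.
Context {M : ZF_model}.
Implicit Types i j k m n x y : M.

Lemma omega_ex : exists w : M, forall n, n ∈ w <-> forall I, inductive I -> n ∈ I.
Proof.
  destruct (infinity M) as [a [[e [He He']] Hs]].
  assert (Ha : inductive a).
  { split.
    - replace empty with e; [exact He|].
      apply extensionality. intro x.
      split; intro H; [destruct (He' x H) | destruct (in_empty x H)].
    - intros x Hx. destruct (Hs x Hx) as [s [Hsa Hs']].
      replace (succ x) with s; [exact Hsa|].
      apply extensionality. intro y. rewrite Hs', in_succ. tauto. }
  destruct (sep_ex a (fun n => forall I, inductive I -> n ∈ I)) as [w Hw].
  - unfold inductive. definability.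
  - exists w. intro n. rewrite Hw. split; [tauto|]. intro H. split; auto.
Qed.

Lemma in_omega n : n ∈ omega <-> forall I, inductive I -> n ∈ I.
Proof. unfold omega. apply setof_spec. apply omega_ex. Qed.

Lemma zero_omega : (empty : M) ∈ omega.
Proof. apply in_omega. intros I [H _]. exact H. Qed.

Lemma succ_omega n : n ∈ omega -> succ n ∈ omega.
Proof.
  intro H. apply in_omega. intros I HI.
  apply (proj2 HI). revert HI. apply in_omega. exact H.
Qed.

(** The part of [omega] where [P] holds is inductive. It has to be a set of the model, hence the
    restriction to definable [P]. *)
Lemma omega_ind (P : M -> Prop) : definable (fun e => P (e 0)) ->
  P empty -> (forall n, n ∈ omega -> P n -> P (succ n)) ->
  forall n, n ∈ omega -> P n.
Proof.
  intros HP H0 HS n Hn.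
  destruct (sep_ex omega P HP) as [I HI].
  apply HI. apply (proj1 (in_omega n) Hn). split.
  - apply HI. split; [apply zero_omega | exact H0].
  - intros x Hx. apply HI in Hx. apply HI.
    destruct Hx. split; [apply succ_omega | apply HS]; assumption.
Qed.

(** Two sets belonging to each other would leave their unordered pair without a minimal member,
    against foundation. *)
Lemma mem_asym x y : x ∈ y -> y ∉ x.
Proof.
  intros H K. destruct (foundation M (upair x y)) as [t [Ht Hmin]].
  - exists x. apply in_upair. auto.
  - apply in_upair in Ht. destruct Ht; subst t.
    + apply (Hmin y K). apply in_upair. auto.
    + apply (Hmin x H). apply in_upair. auto.
Qed.

Lemma mem_irrefl x : x ∉ x.
Proof. intro H. exact (mem_asym x x H H). Qed.

Lemma succ_inj x y : succ x = succ y -> x = y.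
Proof.
  intro E.
  assert (H : x ∈ succ y) by (rewrite <- E; apply in_succ; auto).
  assert (K : y ∈ succ x) by (rewrite E; apply in_succ; auto).
  apply in_succ in H, K. destruct H as [H|H]; auto.
  destruct K as [K|K]; auto. destruct (mem_asym x y H K).
Qed.

Lemma succ_neq_empty x : succ x <> empty.
Proof.
  intro E. apply (in_empty x). rewrite <- E. apply in_succ. auto.
Qed.

Lemma omega_trans n : n ∈ omega -> forall m k, k ∈ m -> m ∈ n -> k ∈ n.
Proof.
  revert n. refine (omega_ind _ _ _ _).
  - definability.
  - intros m k _ H. destruct (in_empty m H).
  - intros n Hn IH m k Hk Hm. apply in_succ. left.
    apply in_succ in Hm. destruct Hm; subst; eauto.
Qed.

Lemma omega_zero n : n ∈ omega -> n = empty \/ empty ∈ n.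
Proof.
  revert n. refine (omega_ind _ _ _ _).
  - definability.
  - auto.
  - intros n Hn [->|H]; right; apply in_succ; auto.
Qed.

Lemma omega_pred n : n ∈ omega -> n = empty \/ exists k, k ∈ omega /\ n = succ k.
Proof.
  revert n. refine (omega_ind _ _ _ _).
  - definability.
  - auto.
  - intros n Hn _. right. exists n. auto.
Qed.

Lemma succ_le n : n ∈ omega -> forall m, m ∈ n -> succ m ∈ n \/ succ m = n.
Proof.
  revert n. refine (omega_ind _ _ _ _).
  - definability.
  - intros m H. destruct (in_empty m H).
  - intros n Hn IH m H. apply in_succ in H. destruct H as [H | ->]; auto.
    left. apply in_succ. auto.
Qed.

Lemma trichotomy m : m ∈ omega ->
  forall n, n ∈ omega -> m ∈ n \/ m = n \/ n ∈ m.
Proof.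
  revert m. refine (omega_ind _ _ _ _).
  - definability.
  - intros n Hn. destruct (omega_zero n Hn); auto.
  - intros m Hm IH n Hn. destruct (IH n Hn) as [H|[->|H]].
    + destruct (succ_le n Hn m H); auto.
    + right. right. apply in_succ. auto.
    + right. right. apply in_succ. auto.
Qed.

End Omega.

(** * Countable sets *)

Section Countable.
Context {M : ZF_model}.
Implicit Types i j k m n p q x y z D X : M.

Lemma countable_omega_subset D : D ⊆ omega -> countable D.
Proof.
  intro HD.
  destruct (function_build D omega (fun x y => y = x)) as [f [Hf Hm]].
  - definability.
  - intros x Hx. exists x. split; auto.
  - intros x y Hx ->. apply HD. exact Hx.
  - exists f. split; [exact Hf|].
    intros x x' y H H'. apply Hm in H, H'. destruct H, H'. congruence.
Qed.

(** Each [y] is sent to the least index of a preimage, so that no preimage has to be chosen. *)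
Lemma countable_image D z (R : M -> M -> Prop) :
  definable (fun e => R (e 0) (e 1)) -> countable D ->
  (forall y, y ∈ z -> exists d, d ∈ D /\ R d y) ->
  (forall d y y', R d y -> R d y' -> y = y') ->
  countable z.
Proof.
  intros HR [g [Hg Hinj]] Hsurj Hfun.
  set (hit := fun y n => exists d, opair d n ∈ g /\ R d y).
  assert (Hom : forall y n, hit y n -> n ∈ omega).
  { intros y n [d [Hd _]]. exact (proj2 (function_range _ _ _ _ _ Hg Hd)). }
  assert (Dhit : definable (fun e : nat -> M => hit (e 0) (e 1))).
  { unfold hit. definability. }
  destruct (function_build z omega
    (fun y n => hit y n /\ forall m, m ∈ n -> ~ hit y m)) as [f [Hf Hm]].
  - definability.
  - intros y Hy. destruct (Hsurj y Hy) as [d [Hd HRd]].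
    destruct (function_total _ _ _ _ Hg Hd) as [n0 [Hn0 Hgn0]].
    destruct (sep_ex omega (hit y)) as [S HS].
    + apply (definable_app2 hit); [exact Dhit | definability | definability].
    (* Foundation gives a minimal index in [S]; trichotomy on [omega] then makes it unique. *)
    + destruct (foundation M S) as [n [Hn Hmin]].
      * exists n0. apply HS. split; [exact Hn0|]. exists d. auto.
      * apply HS in Hn. destruct Hn as [Hn Hhit].
        assert (Hleast : forall m, m ∈ n -> ~ hit y m).
        { intros m Hmn Hh. apply (Hmin m Hmn). apply HS. eauto. }
        exists n. split; [auto|].
        intros n' [Hhit' Hleast'].
        destruct (trichotomy n Hn n' (Hom _ _ Hhit')) as [H|[H|H]]; auto.
        -- destruct (Hleast' n H Hhit).
        -- destruct (Hleast n' H Hhit').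
  - intros y n _ [H _]. exact (Hom _ _ H).
  - exists f. split; [exact Hf|].
    intros y y' n H H'. apply Hm in H, H'.
    destruct H as (_ & [d [Hd HRd]] & _), H' as (_ & [d' [Hd' HRd']] & _).
    rewrite (Hinj _ _ _ Hd Hd') in HRd. exact (Hfun _ _ _ HRd HRd').
Qed.

(* The walk (0,0), (0,1), (1,0), (1,1), (0,2), (1,2), (2,0), (2,1), (2,2), ...
   visits every pair; the k-th shell consists of the pairs with maximum k. *)
Definition walk_step p q : Prop :=
  exists m n, p = opair m n /\
    ((n ∈ m /\ q = opair m (succ n)) \/
     (n = m /\ q = opair empty (succ m)) \/
     (m ∈ n /\ succ m <> n /\ q = opair (succ m) n) \/
     (succ m = n /\ q = opair n empty)).

(** The four cases of a step exclude each other by asymmetry and irreflexivity of membership. *)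
Lemma walk_step_fun p q q' : walk_step p q -> walk_step p q' -> q = q'.
Proof.
  intros (m & n & -> & H) (m' & n' & E & H').
  apply opair_inj in E as [<- <-].
  assert (A : succ m = n -> m ∈ n) by (intros <-; apply in_succ; auto).
  assert (B : m ∈ n -> n ∉ m) by apply mem_asym.
  assert (C : n = m -> n ∉ m) by (intros ->; apply mem_irrefl).
  assert (D : n = m -> m ∉ n) by (intros ->; apply mem_irrefl).
  destruct H as [[H1 ->]|[[H1 ->]|[[H1 [H2 ->]]|[H1 ->]]]];
    destruct H' as [[H1' ->]|[[H1' ->]|[[H1' [H2' ->]]|[H1' ->]]]];
    solve [reflexivity | exfalso; tauto].
Qed.

(* [s] is a finite piece of the walk: it need not be total below [k], but each
   of its entries has its whole past in [s]. *)
Definition walk_at k p : Prop :=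
  exists s, opair k p ∈ s /\
    forall r, r ∈ s ->
      r = opair empty (opair empty empty) \/
      exists i p' q', opair i p' ∈ s /\ walk_step p' q' /\ r = opair (succ i) q'.

Lemma definable_walk_at : definable (fun e : nat -> M => walk_at (e 0) (e 1)).
Proof. unfold walk_at, walk_step. definability. Qed.

Lemma walk_at_zero : walk_at empty (opair empty empty).
Proof.
  exists (sing (opair empty (opair empty empty))).
  split; [apply in_sing; reflexivity|].
  intros r Hr. apply in_sing in Hr. auto.
Qed.

Lemma walk_at_succ k p q :
  walk_at k p -> walk_step p q -> walk_at (succ k) q.
Proof.
  intros [s [Hs Hall]] Hstep.
  exists (cup s (sing (opair (succ k) q))). split.
  - apply in_cup. right. apply in_sing. reflexivity.
  - intros r Hr. apply in_cup in Hr. destruct Hr as [Hr|Hr].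
    + destruct (Hall r Hr) as [H|(i & p' & q' & H1 & H2 & H3)]; [auto|].
      right. exists i, p', q'. rewrite in_cup. auto.
    + apply in_sing in Hr. right. exists k, p, q. rewrite in_cup. auto.
Qed.

(** An entry at index [empty] can only be the starting pair, and an entry at [succ k] comes by one
    step from an entry at [k] in the same piece; induction then uses that steps are functional. *)
Lemma walk_at_fun k : k ∈ omega ->
  forall p p', walk_at k p -> walk_at k p' -> p = p'.
Proof.
  revert k. pose proof definable_walk_at as HW. refine (omega_ind _ _ _ _).
  - definability.
  - assert (K : forall p, walk_at empty p -> p = opair empty empty).
    { intros p [s [Hs Hall]].
      destruct (Hall _ Hs) as [H|(i & p1 & q1 & _ & _ & H)];
        apply opair_inj in H as [H1 H2]; auto.
      destruct (succ_neq_empty i). auto. }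
    intros p p' H H'. rewrite (K p H), (K p' H'). reflexivity.
  - intros k Hk IH.
    assert (K : forall p, walk_at (succ k) p ->
                exists r, walk_at k r /\ walk_step r p).
    { intros p [s [Hs Hall]].
      destruct (Hall _ Hs) as [H|(i & p1 & q1 & H & Hst & E)].
      - apply opair_inj in H as [H _]. destruct (succ_neq_empty k H).
      - apply opair_inj in E as [E ->]. apply succ_inj in E as <-.
        exists p1. split; [exists s; auto | exact Hst]. }
    intros p p' H H'.
    destruct (K p H) as (r & Hr & Hst), (K p' H') as (r' & Hr' & Hst').
    rewrite (IH r' r Hr' Hr) in Hst'. exact (walk_step_fun _ _ _ Hst Hst').
Qed.

(** Induction over shells. [Hcol] runs through the pairs [(m, k+1)] with [m] at most [k], and [Hrow]
    through the pairs [(k, n)] with [n] at most [k]; each of the two stretches ends where the next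
    one starts, which is how [Hshell] advances. *)
Lemma walk_surjective m n : m ∈ omega -> n ∈ omega ->
  exists k, k ∈ omega /\ walk_at k (opair m n).
Proof.
  set (hit := fun m n => exists k, k ∈ omega /\ walk_at k (opair m n)).
  assert (Dhit : definable (fun e : nat -> M => hit (e 0) (e 1))).
  { pose proof definable_walk_at as HW. unfold hit. definability. }
  assert (Hstep : forall m n m' n', hit m n ->
            walk_step (opair m n) (opair m' n') -> hit m' n').
  { intros a b a' b' (k & Hk & Hw) Hs. exists (succ k).
    split; [apply succ_omega; exact Hk | exact (walk_at_succ _ _ _ Hw Hs)]. }
  assert (Hrow : forall k, k ∈ omega -> hit k empty -> forall n, n ∈ omega ->
            n ∈ k \/ n = k -> hit k n).
  { intros k Hk H0. refine (omega_ind (fun n => n ∈ k \/ n = k -> hit k n) _ _ _).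
    - definability.
    - auto.
    - intros a Ha IH H.
      assert (Hak : a ∈ k).
      { assert (H1 : a ∈ succ a) by (apply in_succ; auto).
        destruct H as [H | <-]; [exact (omega_trans k Hk (succ a) a H1 H) | exact H1]. }
      apply (Hstep k a); [auto|]. exists k, a. auto. }
  assert (Hcol : forall k, k ∈ omega -> hit empty (succ k) ->
            forall m, m ∈ omega -> m ∈ succ k -> hit m (succ k)).
  { intros k Hk H0. refine (omega_ind (fun m => m ∈ succ k -> hit m (succ k)) _ _ _).
    - definability.
    - auto.
    - intros a Ha IH H.
      assert (Hak : a ∈ succ k).
      { apply omega_trans with (succ a); [apply succ_omega; exact Hk | | exact H].
        apply in_succ. auto. }
      apply (Hstep a (succ k)); [auto|]. exists a, (succ k). split; [reflexivity|].
      right; right; left. repeat split; auto.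
      intro E. rewrite E in H. exact (mem_irrefl _ H). }
  assert (Hshell : forall k, k ∈ omega -> hit k empty /\ hit empty (succ k)).
  { assert (Hnext : forall k, k ∈ omega -> hit k empty -> hit empty (succ k)).
    { intros k Hk H. apply (Hstep k k).
      - apply (Hrow k Hk H k Hk). auto.
      - exists k, k. auto. }
    refine (omega_ind (fun k => hit k empty /\ hit empty (succ k)) _ _ _).
    - definability.
    - assert (H0 : hit empty empty).
      { exists empty. split; [apply zero_omega | apply walk_at_zero]. }
      split; [exact H0 | apply (Hnext empty zero_omega H0)].
    - intros k Hk [H1 H2].
      assert (H : hit (succ k) empty).
      { apply (Hstep k (succ k)).
        - apply (Hcol k Hk H2 k Hk). apply in_succ. auto.
        - exists k, (succ k). split; [reflexivity|]. auto. }
      split; [exact H | exact (Hnext _ (succ_omega _ Hk) H)]. }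
  intros Hm Hn. change (hit m n).
  (* The larger coordinate names the shell; [m] below [n] means the first stretch of it, otherwise
     the second. *)
  destruct (trichotomy m Hm n Hn) as [H|H].
  - destruct (omega_pred n Hn) as [->|[k [Hk ->]]].
    + destruct (in_empty m H).
    + exact (Hcol k Hk (proj2 (Hshell k Hk)) m Hm H).
  - apply (Hrow m Hm (proj1 (Hshell m Hm)) n Hn). destruct H; auto.
Qed.

(* Enumerating the indices [(m, n)] by the walk turns the doubly indexed
   family [T] into a simply indexed one; no choice is involved because the
   enumerations are given uniformly by [T]. *)
Lemma countable_omega_union z (T : M -> M -> M -> Prop) :
  definable (fun e => T (e 0) (e 1) (e 2)) ->
  (forall y, y ∈ z -> exists m n, m ∈ omega /\ n ∈ omega /\ T m n y) ->
  (forall m n y y', T m n y -> T m n y' -> y = y') ->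
  countable z.
Proof.
  intros HT Hsurj Hfun. pose proof definable_walk_at as HW.
  apply (countable_image omega z
    (fun k y => k ∈ omega /\ exists m n, walk_at k (opair m n) /\ T m n y)).
  - definability.
  - apply countable_omega_subset. intros x Hx. exact Hx.
  - intros y Hy. destruct (Hsurj y Hy) as (m & n & Hm & Hn & Hy').
    destruct (walk_surjective m n Hm Hn) as (k & Hk & Hw).
    exists k. split; [exact Hk|]. split; [exact Hk|]. eauto.
  - intros k y y' [Hk (m & n & Hw & Hy)] [_ (m' & n' & Hw' & Hy')].
    pose proof (walk_at_fun k Hk _ _ Hw Hw') as E.
    apply opair_inj in E as [<- <-]. eauto.
Qed.

(** An injection of [D] into [omega] replaces the index [d] by a number. *)
Lemma countable_union D z (T : M -> M -> M -> Prop) :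
  definable (fun e => T (e 0) (e 1) (e 2)) -> countable D ->
  (forall y, y ∈ z -> exists d n, d ∈ D /\ n ∈ omega /\ T d n y) ->
  (forall d n y y', T d n y -> T d n y' -> y = y') ->
  countable z.
Proof.
  intros HT [g [Hg Hinj]] Hsurj Hfun.
  apply (countable_omega_union z (fun m n y => exists d, opair d m ∈ g /\ T d n y)).
  - definability.
  - intros y Hy. destruct (Hsurj y Hy) as (d & n & Hd & Hn & Hy').
    destruct (function_total _ _ _ _ Hg Hd) as [m [Hm Hgm]].
    exists m, n. eauto.
  - intros m n y y' [d [Hd Hy]] [d' [Hd' Hy']].
    rewrite (Hinj _ _ _ Hd' Hd) in Hy'. eauto.
Qed.

Lemma countable_cup x y : countable x -> countable y -> countable (cup x y).
Proof.
  intros [f [Hf If]] [g [Hg Ig]].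
  (* The first index is a label: [empty] stands for [x], any other number for [y]. *)
  apply (countable_omega_union _
    (fun m n t => (m = empty /\ opair t n ∈ f) \/
                  (m <> empty /\ opair t n ∈ g))).
  - definability.
  - intros t Ht. apply in_cup in Ht. destruct Ht as [Ht|Ht].
    + destruct (function_total _ _ _ _ Hf Ht) as [n [Hn Hm]].
      exists empty, n. repeat split; auto. apply zero_omega.
    + destruct (function_total _ _ _ _ Hg Ht) as [n [Hn Hm]].
      exists (succ empty), n. split; [apply succ_omega, zero_omega|].
      split; [exact Hn|]. right. split; [apply succ_neq_empty | exact Hm].
  - intros m n t t' [[H1 H2]|[H1 H2]] [[H1' H2']|[H1' H2']];
      try contradiction; eauto.
Qed.

Lemma countable_subset x y : x ⊆ y -> countable y -> countable x.
Proof.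
  intros H Hy. apply (countable_image y x (fun d t => t = d)).
  - definability.
  - exact Hy.
  - intros t Ht. exists t. auto.
  - intros d t t' -> ->. reflexivity.
Qed.

Lemma countable_sing x : countable (sing x).
Proof.
  apply (countable_image omega _ (fun _ t => t = x)).
  - definability.
  - apply countable_omega_subset. intros t Ht. exact Ht.
  - intros t Ht. apply in_sing in Ht. exists empty. split; [apply zero_omega | exact Ht].
  - intros d t t' -> ->. reflexivity.
Qed.

Lemma in_countable_subsets X x :
  x ∈ countable_subsets X <-> x ⊆ X /\ countable x.
Proof.
  apply (setof_sep (powerset X) (fun x => x ⊆ X /\ countable x)
           (fun x => x ⊆ X /\ countable x)).
  - tauto.
  - intros y [Hy _]. apply in_powerset. exact Hy.
  - definability.
Qed.

End Countable.

(** * Spaces given by neighbourhoods indexed by countable sets *)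

Section Neighbourhoods.
Context {M : ZF_model}.
Implicit Types U V F G X Z x y z : M.

(* [N x z y]: the point [y] lies in the basic neighbourhood of [x] given by the
   countable set [z]. *)
Definition nbhd_open (Pt X : M) (N : M -> M -> M -> Prop) V : Prop :=
  V ⊆ Pt /\ forall x, x ∈ V -> exists z, z ∈ countable_subsets X /\
    forall y, y ∈ Pt -> N x z y -> y ∈ V.

Lemma definable_nbhd_open (Pt X : M) (N : M -> M -> M -> Prop) :
  definable (fun e => N (e 0) (e 1) (e 2)) ->
  definable (fun e => nbhd_open Pt X N (e 0)).
Proof. intro HN. unfold nbhd_open. definability. Qed.

(** Codes a countable set by an element of [funset omega X], where choice is available. The
    injection is inverted, and [a] fills the indices it misses, so the range may exceed [z] by
    [a]. *)
Lemma enumerate_countable X z a :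
  z ⊆ X -> countable z -> a ∈ X ->
  exists s, is_function s omega X /\
    forall t, t ∈ z -> exists n, opair n t ∈ s.
Proof.
  intros Hz [f [Hf Hinj]] Ha.
  destruct (function_build omega X
    (fun n t => opair t n ∈ f \/ (t = a /\ ~ exists t', opair t' n ∈ f)))
    as [s [Hs Hm]].
  - definability.
  - intros n Hn. destruct (classic (exists t', opair t' n ∈ f)) as [[t Ht]|H].
    + exists t. split; [auto|]. intros t' [H|[_ H]]; [eauto|].
      destruct H. eauto.
    + exists a. split; [auto|]. intros t' [H'|[H' _]]; [|auto].
      destruct H. eauto.
  - intros n t _ [H|[-> _]]; [|exact Ha].
    apply Hz. exact (proj1 (function_range _ _ _ _ _ Hf H)).
  - exists s. split; [exact Hs|]. intros t Ht.
    destruct (function_total _ _ _ _ Hf Ht) as [n [Hn Hfn]].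
    exists n. apply Hm. auto.
Qed.

(** Of the neighbourhoods only definability and shrinking in [z] matter, so one argument serves all
    three spaces. The point [a] is the default value of the enumerations. *)
Lemma P_space_nbhd (T : space M) X (N : M -> M -> M -> Prop) a :
  CAC (funset omega X) -> a ∈ X ->
  definable (fun e => N (e 0) (e 1) (e 2)) ->
  (forall x z z' y, z ⊆ z' -> N x z' y -> N x z y) ->
  (forall V, V ∈ opens T <-> nbhd_open (points T) X N V) ->
  P_space T.
Proof.
  intros HCAC Ha HN Hmono Hopen. split; [split; [|split; [|split; [|split]]]|].
  - intros V HV. apply Hopen in HV. apply in_powerset. apply HV.
  - apply Hopen. split; intros x Hx; destruct (in_empty x Hx).
  - apply Hopen. split; [intros x Hx; exact Hx|].
    intros x Hx. exists (sing a). split; [|auto].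
    apply in_countable_subsets. split; [|apply countable_sing].
    intros t Ht. apply in_sing in Ht. subst t. exact Ha.
  - intros U V HU HV. apply Hopen in HU, HV. apply Hopen.
    assert (Hcap : forall x, x ∈ cap U V <-> x ∈ U /\ x ∈ V).
    { apply (setof_sep U (fun x => x ∈ U /\ x ∈ V)); [tauto | tauto | definability]. }
    split.
    + intros x Hx. apply Hcap in Hx. apply HU. tauto.
    + intros x Hx. apply Hcap in Hx. destruct Hx as [Hx1 Hx2].
      destruct (proj2 HU x Hx1) as (z1 & Hz1 & H1).
      destruct (proj2 HV x Hx2) as (z2 & Hz2 & H2).
      apply in_countable_subsets in Hz1 as [Hz1 Hc1], Hz2 as [Hz2 Hc2].
      exists (cup z1 z2). split.
      * apply in_countable_subsets. split; [|apply countable_cup; assumption].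
        intros t Ht. apply in_cup in Ht. destruct Ht; auto.
      * intros y Hy HNy. apply Hcap. split.
        -- apply H1; [exact Hy|]. apply (Hmono x _ (cup z1 z2)); [|exact HNy].
           intros t Ht. apply in_cup. auto.
        -- apply H2; [exact Hy|]. apply (Hmono x _ (cup z1 z2)); [|exact HNy].
           intros t Ht. apply in_cup. auto.
  - intros F HF. apply Hopen. split.
    + intros x Hx. apply in_Union in Hx as [U [HU Hx]].
      apply HF, Hopen in HU. apply HU. exact Hx.
    + intros x Hx. apply in_Union in Hx as [U [HU Hx]].
      pose proof (proj1 (Hopen U) (HF U HU)) as [_ K].
      destruct (K x Hx) as (z & Hz & Hzy).
      exists z. split; [exact Hz|]. intros y Hy HNy.
      apply in_Union. exists U. auto.
  - intros G (F & HFc & HF & ->).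
    assert (HG : forall x, x ∈ {{ x | x ∈ points T /\ forall U, U ∈ F -> x ∈ U }}
                 <-> x ∈ points T /\ forall U, U ∈ F -> x ∈ U).
    { apply (setof_sep (points T)
        (fun x => x ∈ points T /\ forall U, U ∈ F -> x ∈ U));
        [tauto | tauto | definability]. }
    apply Hopen. split; [intros x Hx; apply HG in Hx; exact (proj1 Hx)|].
    intros x Hx. apply HG in Hx. destruct Hx as [Hx HxF].
    (* [good U s]: the range of [s] gives a neighbourhood of [x] inside [U] *)
    set (good := fun U s => is_function s omega X /\
      forall y, y ∈ points T ->
        (forall z, (forall t, t ∈ z <-> exists n, opair n t ∈ s) -> N x z y) ->
        y ∈ U).
    assert (Dgood : definable (fun e : nat -> M => good (e 0) (e 1))).
    { unfold good. definability. }
    assert (Hrange : forall s, is_function s omega X -> exists z,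
              forall t, t ∈ z <-> exists n, opair n t ∈ s).
    { intros s Hs. destruct (sep_ex X (fun t => exists n, opair n t ∈ s)) as [z Hz];
        [definability|].
      exists z. intro t. rewrite Hz. split; [tauto|]. intros [n Hn].
      split; [exact (proj2 (function_range _ _ _ _ _ Hs Hn)) | eauto]. }
    (* Written as a relation, so that Replacement can collect the sets of good enumerations for all
       [U] in [F]. *)
    set (fam := fun U A => forall s, s ∈ A <-> good U s).
    assert (Dfam : definable (fun e : nat -> M => fam (e 0) (e 1))).
    { unfold fam. definability. }
    assert (fam_fun : forall U A A', fam U A -> fam U A' -> A = A').
    { intros U A A' H H'. apply extensionality. intro s.
      rewrite (H s), (H' s). tauto. }
    assert (fam_ex : forall U, exists A, fam U A).
    { intro U. destruct (sep_ex (funset omega X) (good U)) as [A HA].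
      - apply (definable_app2 good); [exact Dgood | definability | definability].
      - exists A. intro s. rewrite HA, in_funset.
        split; [tauto|]. intro H. split; [apply H | exact H]. }
    destruct (repl_ex F fam) as [A HA]; [exact Dfam | |].
    { intros U _. destruct (fam_ex U) as [B HB]. exists B. split; eauto. }
    (* The only use of choice: one good enumeration from each set of the family, countable as an
       image of [F]. *)
    destruct (HCAC A) as [c [Hc Hchoice]].
    { apply (countable_image F A fam); [exact Dfam | exact HFc | | exact fam_fun].
      intros B HB. apply HA in HB. exact HB. }
    { intros B HB. apply HA in HB as [U [HU HB]]. split.
      - intros s Hs. apply in_funset. apply HB in Hs. apply Hs.
      - pose proof (proj1 (Hopen U) (HF U HU)) as [_ K].
        destruct (K x (HxF U HU)) as (z & Hz & Hzy).
        apply in_countable_subsets in Hz as [Hz Hzc].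
        destruct (enumerate_countable X z a Hz Hzc Ha) as [s [Hs Hzs]].
        exists s. apply HB. split; [exact Hs|].
        intros y Hy HNy. apply Hzy; [exact Hy|].
        destruct (Hrange s Hs) as [r Hr].
        apply (Hmono x z r); [|apply HNy; exact Hr].
        intros t Ht. apply Hr. auto. }
    (* The union of the ranges of all chosen enumerations is the index set for the whole
       intersection. *)
    destruct (sep_ex X (fun t => exists U n B s, U ∈ F /\ fam U B /\
                          opair B s ∈ c /\ opair n t ∈ s)) as [z Hz];
      [definability|].
    exists z. split.
    + apply in_countable_subsets. split; [intros t Ht; apply Hz in Ht; apply Ht|].
      (* [t] is the [n]-th value of the enumeration chosen for [U]. *)
      apply (countable_union F z (fun U n t => exists B s, fam U B /\
                opair B s ∈ c /\ opair n t ∈ s /\ is_function s omega X)).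
      * definability.
      * exact HFc.
      * intros t Ht. apply Hz in Ht as [_ (U & n & B & s & HU & HB & Hs & Hn)].
        assert (Hsf : is_function s omega X).
        { pose proof (Hchoice _ _ Hs) as H. apply HB in H. apply H. }
        exists U, n. split; [exact HU|].
        split; [exact (proj1 (function_range _ _ _ _ _ Hsf Hn)) | eauto 6].
      * intros U n t t' (B & s & HB & Hs & Hn & Hsf) (B' & s' & HB' & Hs' & Hn' & _).
        rewrite (fam_fun U B' B HB' HB) in Hs'.
        rewrite (function_single _ _ _ _ _ _ Hc Hs' Hs) in Hn'.
        exact (function_single _ _ _ _ _ _ Hsf Hn Hn').
    + intros y Hy HNy. apply HG. split; [exact Hy|]. intros U HU.
      destruct (fam_ex U) as [B HB].
      assert (HBA : B ∈ A) by (apply HA; eauto).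
      destruct (function_total _ _ _ _ Hc HBA) as [s [_ Hs]].
      pose proof (Hchoice _ _ Hs) as H. apply HB in H. destruct H as [Hsf H].
      (* The range [r] of the enumeration chosen for [U] is part of [z], so the neighbourhood given
         by [z] lies in the one given by [r]. *)
      apply H; [exact Hy|]. intros r Hr. apply (Hmono x r z); [|exact HNy].
      intros t Ht. apply Hr in Ht as [n Hn]. apply Hz.
      split; [exact (proj2 (function_range _ _ _ _ _ Hsf Hn)) | eauto 10].
Qed.

End Neighbourhoods.

(** * The spaces of subsets and of functions into [two] *)

Section Spaces.
Context {M : ZF_model}.
Implicit Types A U V F X x y z f g h : M.

Lemma uncountable_inhabited X : uncountable X -> exists a, a ∈ X.
Proof.
  intro H. apply NNPP. intro K. apply H. apply countable_omega_subset.
  intros x Hx. destruct K. eauto.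
Qed.

Lemma setminus_ex x z : exists b, forall t, t ∈ b <-> t ∈ x /\ t ∉ z.
Proof. apply sep_ex. definability. Qed.

Lemma in_setminus x z t : t ∈ setminus x z <-> t ∈ x /\ t ∉ z.
Proof. exact (setof_spec _ (setminus_ex x z) t). Qed.

Lemma cap_empty x z : cap x z = empty <-> forall t, t ∈ x -> t ∉ z.
Proof.
  assert (Hcap : forall t, t ∈ cap x z <-> t ∈ x /\ t ∈ z).
  { apply setof_spec. apply sep_ex. definability. }
  split.
  - intros E t Hx Hz. apply (in_empty t). rewrite <- E. apply Hcap. auto.
  - intro H. apply extensionality. intro t. rewrite Hcap. split.
    + intros [Hx Hz]. destruct (H t Hx Hz).
    + intro K. destruct (in_empty t K).
Qed.

Lemma S_fam_opens A X V : A ⊆ powerset X ->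
  V ∈ opens (S_fam A X (countable_subsets X)) <->
  nbhd_open A X (fun x z y => x ⊆ y /\ forall t, t ∈ y -> t ∈ z -> t ∈ x) V.
Proof.
  intro HA. set (N := fun x z y => x ⊆ y /\ forall t, t ∈ y -> t ∈ z -> t ∈ x).
  assert (HN : definable (fun e : nat -> M => N (e 0) (e 1) (e 2))).
  { unfold N. definability. }
  revert V. apply (setof_sep (powerset A)).
  - intro V. unfold nbhd_open.
    assert (Hbox : forall x z y,
      y ∈ {{ y | y ∈ A /\ x ⊆ y /\ y ⊆ setminus X z }} <->
      y ∈ A /\ x ⊆ y /\ y ⊆ setminus X z).
    { intros x z. apply setof_spec. apply sep_ex. definability. }
    split; intros [HV H]; (split; [exact HV|]); intros x Hx;
      destruct (H x Hx) as (z & Hz & K).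
    + destruct K as [Hxz K]. rewrite cap_empty in Hxz.
      exists z. split; [exact Hz|]. intros y Hy [Hxy Hyz].
      apply K. apply Hbox. split; [exact Hy|]. split; [exact Hxy|].
      intros t Ht. apply in_setminus. split.
      * pose proof (HA y Hy) as HyX. apply in_powerset in HyX. auto.
      * intro Htz. exact (Hxz t (Hyz t Ht Htz) Htz).
    + apply in_countable_subsets in Hz as [HzX Hzc].
      (* Removing [x] restores disjointness without changing the neighbourhood. *)
      exists (setminus z x). split; [|split].
      * apply in_countable_subsets. split.
        -- intros t Ht. apply in_setminus in Ht. apply HzX. tauto.
        -- apply countable_subset with z; [|exact Hzc].
           intros t Ht. apply in_setminus in Ht. tauto.
      * apply cap_empty. intros t Ht Hz. apply in_setminus in Hz. tauto.
      * intros y Hy. apply Hbox in Hy as (Hy & Hxy & Hyz).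
        apply K; [exact Hy|]. split; [exact Hxy|]. intros t Hty Htz.
        apply Hyz, in_setminus in Hty. destruct Hty as [_ Hty].
        apply NNPP. intro Htx. apply Hty, in_setminus. auto.
  - intros V HV. apply in_powerset. apply HV.
  - apply definable_nbhd_open. exact HN.
Qed.

Lemma S_fam_P_space A X :
  CAC (funset omega X) -> uncountable X -> A ⊆ powerset X ->
  P_space (S_fam A X (countable_subsets X)).
Proof.
  intros HC HX HA. destruct (uncountable_inhabited X HX) as [a Ha].
  apply (P_space_nbhd _ X
    (fun x z y => x ⊆ y /\ forall t, t ∈ y -> t ∈ z -> t ∈ x) a HC Ha).
  - definability.
  - intros x z z' y Hz [H K]. split; auto.
  - intro V. apply S_fam_opens. exact HA.
Qed.

Lemma in_finite_subsets X x : x ∈ finite_subsets X <-> x ⊆ X /\ finite x.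
Proof.
  apply (setof_sep (powerset X) (fun x => x ⊆ X /\ finite x)
           (fun x => x ⊆ X /\ finite x)).
  - tauto.
  - intros y [Hy _]. apply in_powerset. exact Hy.
  - unfold finite. definability.
Qed.

Lemma finite_subsets_sub X : finite_subsets X ⊆ powerset X.
Proof.
  intros x Hx. apply in_finite_subsets in Hx. apply in_powerset. tauto.
Qed.

Lemma restriction_is_function f A z B : is_function f A B -> z ⊆ A ->
  exists p, is_function p z B /\
    forall t v, opair t v ∈ p <-> t ∈ z /\ opair t v ∈ f.
Proof.
  intros Hf Hz. apply function_build.
  - definability.
  - intros x Hx. exact (proj2 Hf x (Hz x Hx)).
  - intros x y _ H. exact (proj2 (function_range _ _ _ _ _ Hf H)).
Qed.

(** A condition [p] on [z] that [f] extends is the restriction of [f] to [z], so its extensions are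
    the functions agreeing with [f] on [z]. *)
Lemma two_pow_opens X V a : a ∈ X ->
  V ∈ opens (two_pow X (countable_subsets X)) <->
  nbhd_open (funset X two) X
    (fun f z h => forall t v, t ∈ z -> opair t v ∈ f -> opair t v ∈ h) V.
Proof.
  intro Ha.
  set (N := fun f z h => forall t v, t ∈ z -> opair t v ∈ f -> opair t v ∈ h).
  assert (HN : definable (fun e : nat -> M => N (e 0) (e 1) (e 2))).
  { unfold N. definability. }
  revert V. apply (setof_sep (powerset (funset X two))).
  - intro V. unfold nbhd_open.
    assert (Hext : forall p f, f ∈ extensions X p <-> f ∈ funset X two /\ p ⊆ f).
    { intro p. apply setof_spec. apply sep_ex. definability. }
    split; intros [HV H]; (split; [exact HV|]); intros f Hf;
      destruct (H f Hf) as (z & Hz & K).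
    + destruct K as (p & Hp & Hfp & K).
      apply in_setminus in Hz as [Hz _]. exists z. split; [exact Hz|].
      intros h Hh Hfh. apply K. apply Hext. split; [exact Hh|].
      intros q Hq. apply in_funset in Hp.
      destruct (proj1 Hp q Hq) as (t & v & Ht & Hv & ->).
      apply Hfh; [exact Ht|]. apply Hext in Hfp. apply (proj2 Hfp). exact Hq.
    + apply in_countable_subsets in Hz as [HzX Hzc].
      assert (Hz' : cup z (sing a) ⊆ X).
      { intros t Ht. apply in_cup in Ht. rewrite in_sing in Ht.
        destruct Ht; subst; auto. }
      (* Adjoining [a] makes the index set nonempty, and enlarging [z] only shrinks the
         neighbourhood. *)
      exists (cup z (sing a)). split.
      * apply in_setminus. split.
        -- apply in_countable_subsets. split; [exact Hz'|].
           apply countable_cup; [exact Hzc | apply countable_sing].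
        -- rewrite in_sing. intro E. apply (in_empty a). rewrite <- E.
           apply in_cup. right. apply in_sing. reflexivity.
      * pose proof (HV f Hf) as Hff. apply in_funset in Hff.
        destruct (restriction_is_function f X (cup z (sing a)) two Hff Hz')
          as [p [Hp Hpf]].
        exists p. split; [apply in_funset; exact Hp|]. split.
        -- apply Hext. split; [apply HV; exact Hf|]. intros q Hq.
           destruct (proj1 Hp q Hq) as (t & v & _ & _ & ->).
           apply Hpf in Hq. apply Hq.
        -- intros h Hh. apply Hext in Hh as [Hh Hph]. apply K; [exact Hh|].
           intros t v Ht Htv. apply Hph, Hpf. split; [|exact Htv].
           apply in_cup. auto.
  - intros V HV. apply in_powerset. apply HV.
  - apply definable_nbhd_open. exact HN.
Qed.

Lemma two_pow_P_space X :
  CAC (funset omega X) -> uncountable X ->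
  P_space (two_pow X (countable_subsets X)).
Proof.
  intros HC HX. destruct (uncountable_inhabited X HX) as [a Ha].
  apply (P_space_nbhd _ X
    (fun f z h => forall t v, t ∈ z -> opair t v ∈ f -> opair t v ∈ h) a HC Ha).
  - definability.
  - intros x z z' y Hz H t v Ht. auto.
  - intro V. exact (two_pow_opens X V a Ha).
Qed.

(** The family is pulled back along the bijection [h], a choice is made in [X], and the chosen
    points are pushed forward by [h]. The relation [pre] links a set to its preimage. *)
Lemma CAC_equinumerous X Y : equinumerous X Y -> CAC X -> CAC Y.
Proof.
  intros [h [[Hh Hinj] Hsurj]] HC F HFc HF.
  set (pre := fun A B => forall x, x ∈ B <-> exists y, y ∈ A /\ opair x y ∈ h).
  assert (Dpre : definable (fun e : nat -> M => pre (e 0) (e 1))).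
  { unfold pre. definability. }
  assert (pre_fun : forall A B B', pre A B -> pre A B' -> B = B').
  { intros A B B' H H'. apply extensionality. intro x. rewrite (H x), (H' x). tauto. }
  assert (pre_ex : forall A, exists B, pre A B).
  { intro A. destruct (sep_ex X (fun x => exists y, y ∈ A /\ opair x y ∈ h)) as [B HB];
      [definability|].
    exists B. intro x. rewrite HB. split; [tauto|].
    intros (y & Hy & Hxy). split; [|eauto].
    exact (proj1 (function_range _ _ _ _ _ Hh Hxy)). }
  destruct (repl_ex F pre) as [F' HF']; [exact Dpre| |].
  { intros A _. destruct (pre_ex A) as [B HB]. exists B. split; eauto. }
  destruct (HC F') as [c [Hc Hchoice]].
  - apply (countable_image F F' pre); [exact Dpre | exact HFc | | exact pre_fun].
    intros B HB. apply HF'. exact HB.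
  - intros B HB. apply HF' in HB as [A [HA HB]]. split.
    + intros x Hx. apply HB in Hx as (y & _ & Hxy).
      exact (proj1 (function_range _ _ _ _ _ Hh Hxy)).
    + destruct (HF A HA) as [HAY [y Hy]].
      destruct (Hsurj y (HAY y Hy)) as [x Hx].
      exists x. apply HB. eauto.
  - destruct (function_build F Y
      (fun A y => exists B x, pre A B /\ opair B x ∈ c /\ opair x y ∈ h))
      as [d [Hd Hm]].
    + definability.
    + intros A HA. destruct (pre_ex A) as [B HB].
      destruct (function_total _ _ _ B Hc) as [x [Hx Hcx]]; [apply HF'; eauto|].
      destruct (function_total _ _ _ _ Hh Hx) as [y [Hy Hxy]].
      exists y. split; [eauto|]. intros y' (B' & x' & HB' & Hcx' & Hxy').
      rewrite (pre_fun A B' B HB' HB) in Hcx'.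
      rewrite (function_single _ _ _ _ _ _ Hc Hcx' Hcx) in Hxy'.
      exact (function_single _ _ _ _ _ _ Hh Hxy Hxy').
    + intros A y _ (B & x & _ & _ & Hxy).
      exact (proj2 (function_range _ _ _ _ _ Hh Hxy)).
    + exists d. split; [exact Hd|]. intros A y Hy.
      apply Hm in Hy as [HA (B & x & HB & Hcx & Hxy)].
      apply Hchoice, HB in Hcx. destruct Hcx as (y' & Hy' & Hxy').
      rewrite (function_single _ _ _ _ _ _ Hh Hxy Hxy'). exact Hy'.
Qed.

(** * Countable unions of countable sets *)

Lemma finite_empty : finite (empty : M).
Proof.
  exists empty. split; [apply zero_omega|]. exists empty.
  split; [split; [split|]|].
  - intros p Hp. destruct (in_empty p Hp).
  - intros x Hx. destruct (in_empty x Hx).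
  - intros x x' y Hp. destruct (in_empty _ Hp).
  - intros y Hy. destruct (in_empty y Hy).
Qed.

Lemma finite_sing x : finite (sing x).
Proof.
  exists (succ empty). split; [apply succ_omega, zero_omega|].
  destruct (function_build (sing x) (succ empty) (fun _ y => y = empty))
    as [f [Hf Hm]].
  - definability.
  - intros t _. exists empty. split; auto.
  - intros t y _ ->. apply in_succ. auto.
  - exists f. split; [split; [exact Hf|]|].
    + intros t t' y H H'. apply Hm in H as [H _], H' as [H' _].
      apply in_sing in H, H'. congruence.
    + intros y Hy. exists x. apply Hm. split; [apply in_sing; reflexivity|].
      apply in_succ in Hy. destruct Hy as [Hy|Hy]; [destruct (in_empty y Hy)|exact Hy].
Qed.

Lemma S_fin_not_countable_union X C : uncountable X ->
  P_space (S_fin X (countable_subsets X)) ->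
  countable C -> (forall c, c ∈ C -> countable c) -> X <> Union C.
Proof.
  intros HX [_ HP] HCc HC E.
  pose proof (fun V => S_fam_opens _ X V (finite_subsets_sub X)) as Hopen.
  set (miss := fun c U => forall y, y ∈ U <->
                 y ∈ finite_subsets X /\ forall t, t ∈ y -> t ∉ c).
  assert (Dmiss : definable (fun e : nat -> M => miss (e 0) (e 1))).
  { unfold miss. definability. }
  assert (miss_fun : forall c U U', miss c U -> miss c U' -> U = U').
  { intros c U U' H H'. apply extensionality. intro y. rewrite (H y), (H' y). tauto. }
  assert (miss_ex : forall c, exists U, miss c U).
  { intro c. apply sep_ex. definability. }
  destruct (repl_ex C miss) as [F HF]; [exact Dmiss| |].
  { intros c _. destruct (miss_ex c) as [U HU]. exists U. split; eauto. }
  set (G := {{ x | x ∈ points (S_fin X (countable_subsets X)) /\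
                   forall U, U ∈ F -> x ∈ U }}).
  assert (HG : forall x, x ∈ G <-> x ∈ finite_subsets X /\ forall U, U ∈ F -> x ∈ U).
  { apply setof_spec. apply sep_ex. definability. }
  assert (G0 : empty ∈ G).
  { assert (H0 : empty ∈ finite_subsets X).
    { apply in_finite_subsets. split; [|exact finite_empty].
      intros t Ht. destruct (in_empty t Ht). }
    apply HG. split; [exact H0|]. intros U HU. apply HF in HU as [c [_ HU]].
    apply HU. split; [exact H0|]. intros t Ht. destruct (in_empty t Ht). }
  assert (HGo : G ∈ opens (S_fin X (countable_subsets X))).
  { apply HP. exists F. split; [|split; [|reflexivity]].
    - apply (countable_image C F miss); [exact Dmiss | exact HCc | | exact miss_fun].
      intros U HU. apply HF. exact HU.
    - intros U HU. apply HF in HU as [c [Hc HU]]. apply Hopen. split.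
      + intros y Hy. apply HU in Hy. apply Hy.
      (* The set [c] itself works at every point: a neighbour [y] of [x] meets [c] only inside [x],
         which misses [c]. *)
      + intros x Hx. apply HU in Hx as [_ Hx]. exists c. split.
        * apply in_countable_subsets. split; [|auto].
          intros t Ht. rewrite E. apply in_Union. eauto.
        * intros y Hy [_ Hyc]. apply HU. split; [exact Hy|].
          intros t Hty Htc. exact (Hx t (Hyc t Hty Htc) Htc). }
  apply Hopen in HGo. destruct (proj2 HGo _ G0) as (z & Hz & Hzy).
  apply in_countable_subsets in Hz as [_ Hz].
  apply HX. apply (countable_subset X z); [|exact Hz].
  (* For [t] outside [z], [sing t] is a neighbour of [empty] and so lies in [G], although [t]
     belongs to some [c] in [C]. *)
  intros t Ht. apply NNPP. intro Htz.
  assert (H : sing t ∈ G).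
  { apply Hzy.
    - apply in_finite_subsets. split; [|apply finite_sing].
      intros u Hu. apply in_sing in Hu. subst u. exact Ht.
    - split.
      + intros u Hu. destruct (in_empty u Hu).
      + intros u Hu Huz. apply in_sing in Hu. subst u. contradiction. }
  assert (Hc := Ht). rewrite E in Hc. apply in_Union in Hc as [c [Hc Htc]].
  destruct (miss_ex c) as [U HU].
  apply HG in H as [_ H].
  assert (HUF : U ∈ F) by (apply HF; eauto).
  apply H, HU in HUF as [_ K].
  apply (K t); [apply in_sing; reflexivity | exact Htc].
Qed.

End Spaces.

Theorem theorem8p2 (M : ZF_model) (X : M) (hX : uncountable X) :
  (CAC (funset omega X) ->
     P_space (S_fin X (countable_subsets X)) /\
     P_space (S_pow X (countable_subsets X)) /\
     P_space (two_pow X (countable_subsets X)))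
  /\
  (equinumerous X (funset omega X) -> CAC X ->
     P_space (S_fin X (countable_subsets X)) /\
     P_space (S_pow X (countable_subsets X)) /\
     P_space (two_pow X (countable_subsets X)))
  /\
  (P_space (S_fin X (countable_subsets X)) ->
     ~ exists C : M,
         countable C /\ (forall c, c ∈ C -> countable c) /\ X = Union C).
Proof.
  assert (H : CAC (funset omega X) ->
     P_space (S_fin X (countable_subsets X)) /\
     P_space (S_pow X (countable_subsets X)) /\
     P_space (two_pow X (countable_subsets X))).
  { intro HC. split; [|split].
    - apply S_fam_P_space; [exact HC | exact hX | apply finite_subsets_sub].
    - apply S_fam_P_space; [exact HC | exact hX | intros x Hx; exact Hx].
    - apply two_pow_P_space; assumption. }
  split; [exact H|]. split.
  (* The bijection carries choice from [X] to [funset omega X], reducing (ii) to (i). *)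
  - intros He HC. apply H. exact (CAC_equinumerous _ _ He HC).
  - intros HP (C & HCc & HC & E).
    exact (S_fin_not_countable_union X C hX HP HCc HC E).
Qed.
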